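(* Let $p$ be a prime and $n$ a natural number with $n+1<p$. Let $(A,+,\cdot)$ be a left nilpotent pre-Lie ring of cardinality $p^n$, and define $a\circ b=a+e^{L_{\Omega(a)}}(b)$ (so $(A,\circ)$ is the group of flows). Then $(A,+,\circ)$ is a left brace which is left nilpotent. Moreover, the brace $(A,+,\circ)$ is right nilpotent if and only if the pre-Lie ring $(A,+,\cdot)$ is right nilpotent. Finally, if $(A,+,\cdot_1)$ and $(A,+,\cdot_2)$ are two distinct left nilpotent pre-Lie ring structures on the same abelian group $(A,+)$, then their group-of-flows braces are distinct (i.e. the multiplications $\circ_1,\circ_2$ differ).
   Context: A (left) brace is a set $A$ with binary operations $+,\circ$ such that $(A,+)$ is an abelian group, $(A,\circ)$ is a group, and $a\circ(b+c)+a=a\circ b+a\circ c$ for all $a,b,c$. Write $a*b=a\circ b-a-b$. For additive subgroups $X,Y$, $X*Y$ is the additive subgroup generated by all $x*y$. Set $A^{1}=A^{(1)}=A$, $A^{i+1}=A*A^{i}$, $A^{(i+1)}=A^{(i)}*A$. A brace is left nilpotent if $A^m=0$ for some $m$, right nilpotent if $A^{(m)}=0$ for some $m$. A pre-Lie ring is an abelian group $(A,+)$ with a biadditive product $\cdot$ satisfying $(x\cdot y)\cdot z-x\cdot(y\cdot z)=(y\cdot x)\cdot z-y\cdot(x\cdot z)$. The series $A^i=A\cdot A^{i-1}$, $A^{(i)}=A^{(i-1)}\cdot A$ and left/right nilpotency are defined as for braces with $\cdot$ in place of $*$. Group of flows: let $(A,+,\cdot)$ be a left nilpotent pre-Lie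 ring of cardinality $p^n$ with $p>n+1$ prime. Let $A^{\mathrm{id}}=A\times\mathbb Z$ with $(r,m)+(s,m')=(r+s,m+m')$, $(r,m)\cdot(s,m')=(r\cdot s+ms+m'r,mm')$; identify $A$ with $A\times\{0\}$, put $1=(0,1)$. For $a\in A$ let $L_a(x)=a\cdot x$ and $e^{L_a}(x)=\sum_{j\ge 0}\frac{1}{j!}L_a^j(x)$ for $x\in A^{\mathrm{id}}$ (finite sum since $A^{n+1}=0$; the needed factorials are invertible modulo $p^n$). Let $W(a)=e^{L_a}(1)-1\in A$; $W:A\to A$ is a bijection, with inverse $\Omega$. *)

(* Defs.v *)
From HB Require Import structures.
From mathcomp Require Import all_boot all_order all_algebra.
Set Implicit Arguments. Unset Strict Implicit. Unset Printing Implicit Defensive.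
Import Order.TTheory GRing.Theory Num.Theory.
Local Open Scope ring_scope.

Section Defs.
Variable A : finZmodType.

Inductive addspan (S : A -> Prop) : A -> Prop :=
| addspan_gen x : S x -> addspan S x
| addspan_0 : addspan S 0
| addspan_sub x y : addspan S x -> addspan S y -> addspan S (x - y).

Definition prodset (op : A -> A -> A) (X Y : A -> Prop) : A -> Prop :=
  addspan (fun z => exists x y, X x /\ Y y /\ z = op x y).

Definition allA : A -> Prop := fun _ => True.

(* A^1 = A, A^(i+1) = A * A^i   (lpow 0 is also A, harmless) *)
Fixpoint lpow (op : A -> A -> A) (i : nat) : A -> Prop :=
  match i with
  | 0%N | 1%N => allA
  | S j => prodset op allA (lpow op j)
  end.

Fixpoint rpow (op : A -> A -> A) (i : nat) : A -> Prop :=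
  match i with
  | 0%N | 1%N => allA
  | S j => prodset op (rpow op j) allA
  end.

Definition left_nilpotent (op : A -> A -> A) : Prop :=
  exists m, forall x, lpow op m x -> x = 0.
Definition right_nilpotent (op : A -> A -> A) : Prop :=
  exists m, forall x, rpow op m x -> x = 0.

Definition prelie (mul : A -> A -> A) : Prop :=
  [/\ forall x y z, mul (x + y) z = mul x z + mul y z,
      forall x y z, mul x (y + z) = mul x y + mul x z &
      forall x y z, mul (mul x y) z - mul x (mul y z)
                    = mul (mul y x) z - mul y (mul x z)].

Definition is_group (circ : A -> A -> A) : Prop :=
  [/\ forall x y z, circ x (circ y z) = circ (circ x y) z &
      exists e, (forall x, circ e x = x /\ circ x e = x) /\
                (forall x, exists y, circ x y = e /\ circ y x = e)].

Definition left_brace (circ : A -> A -> A) : Prop :=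
  is_group circ /\
  forall a b c, circ a (b + c) + a = circ a b + circ a c.

Definition brace_star (circ : A -> A -> A) : A -> A -> A :=
  fun a b => circ a b - a - b.

(* division by k in (A,+): the y with k*y = x (unique when k is coprime to #|A|) *)
Definition divA (k : nat) (x : A) : A := odflt 0 [pick y : A | y *+ k == x].

(* e^{L_c}(b) for b in A: sum_{j>=0} (1/j!) L_c^j(b), truncated at j = n
   (L_c^j(b) lies in A^(j+1), which is 0 for j >= n) *)
Definition expL (n : nat) (mul : A -> A -> A) (c b : A) : A :=
  \sum_(j < n.+1) divA j`! (iter j (mul c) b).

(* W(a) = e^{L_a}(1) - 1 in A^id = A x Z.  Since L_a(1) = a (in A),
   L_a^j(1) = L_a^(j-1)(a) for j >= 1; truncated at j = n. *)
Definition Wmap (n : nat) (mul : A -> A -> A) (a : A) : A :=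
  \sum_(1 <= j < n.+1) divA j`! (iter j.-1 (mul a) a).

Definition Omega (n : nat) (mul : A -> A -> A) (a : A) : A :=
  odflt 0 [pick b : A | Wmap n mul b == a].

Definition flow_circ (n : nat) (mul : A -> A -> A) : A -> A -> A :=
  fun a b => a + expL n mul (Omega n mul a) b.

End Defs.

(* Main.v *)
(** Let [m_j] be an inverse of [j!] modulo the exponent of [A] and let [E(x)] be
    the truncated exponential. On [A^id] the products of [n + 1] left
    multiplications vanish, and the key point is the Lazard form of
    Baker-Campbell-Hausdorff: if [L] is a Lie subring of a ring in which
    [(n + 1)]-fold products of elements of [L] vanish, then [E(L)] is closed
    under multiplication. To see this, write [E(tX) E(tY) = E(Z(t))] and
    determine [Z] one coefficient at a time: with the derivation [D = t d/dt],
    both [D(E(Z)) = E(Z) w] and [D(E(tX) E(tY)) = E(tX) E(tY) u] hold with [w], [u]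
    having coefficients in [L], and comparing coefficients of degree [k + 1]
    exhibits [(k + 1)] times the next coefficient of [Z] as a Lie element.

    Hence the operators [E(L_c)] form a group acting on [1 + A]. An operator
    [E(L_c)] fixing [1] has [c = 0], so the action is regular, [W] is injective,
    and the brace axioms follow. Since [L_c] is a combination of the positive
    powers of [E(L_c) - 1] and conversely, and since [W] permutes each two-sided
    ideal, the right series of the brace and of the pre-Lie ring coincide, and
    the brace determines every [L_c]. *)
From HB Require Import structures.
From mathcomp Require Import all_boot all_order all_algebra.
From mathcomp Require Import boolp zify.
Require Import Defs.
Set Implicit Arguments. Unset Strict Implicit. Unset Printing Implicit Defensive.
Import GRing.Theory.
Local Open Scope ring_scope.

(** * The truncated exponential modulo [q] *)

(** The Bezout coefficient of [k] as a natural number: in a group killed by [q], dividing by [k]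
    becomes taking a multiple. *)
Definition invmod (q k : nat) : nat := (egcdn k q).1.

Lemma invmodP q k : (0 < k)%N -> coprime k q -> (k * invmod q k = 1 %[mod q])%N.
Proof.
move=> k0 ckq; rewrite /invmod; case: egcdnP => //= km kn e _.
by rewrite mulnC e (eqP ckq) modnMDl.
Qed.

Definition ifact (q j : nat) : nat := invmod q j`!.

Definition factorials_coprime q n := forall j, (j <= n)%N -> coprime j`! q.

(** * Inverse factorials acting on a group killed by [q] *)

Section Torsion.
Variables (q n : nat) (M : zmodType).
Hypothesis tor : forall x : M, x *+ q = 0.
Hypothesis cop : factorials_coprime q n.

Lemma mulrn_eqmod a b (x : M) : (a = b %[mod q])%N -> x *+ a = x *+ b.
Proof.
have mod_q c : x *+ c = x *+ (c %% q).
  by rewrite {1}(divn_eq c q) mulrnDr mulnC mulrnA tor mul0rn add0r.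
by move=> e; rewrite mod_q e -mod_q.
Qed.

Lemma ifactP j : (j <= n)%N -> (j`! * ifact q j = 1 %[mod q])%N.
Proof. by move=> jn; apply: invmodP; [apply: fact_gt0 | apply: cop]. Qed.

Lemma mulrn_ifact j (x : M) : (j <= n)%N -> x *+ j`! *+ ifact q j = x.
Proof. by move=> jn; rewrite -mulrnA (mulrn_eqmod _ (ifactP jn)). Qed.

Lemma ifact_bin k i : (i <= k)%N -> (k <= n)%N ->
  (ifact q k * 'C(k, i) = ifact q (k - i) * ifact q i %[mod q])%N.
Proof.
move=> ik kn.
have kin : (k - i <= n)%N by lia.
have i_n : (i <= n)%N by lia.
have ck := ifactP kn; have ci := ifactP i_n; have cki := ifactP kin.
have := bin_fact ik => bf.
(* The inserted product is 1 modulo [q]; regrouping it with the binomial exposes the factorial of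
   [k] through [bin_fact]. *)
transitivity ((ifact q k * 'C(k, i)) * ((i`! * ifact q i) * ((k - i)`! * ifact q (k - i))) %% q)%N.
  by rewrite -[RHS]modnMmr -[in RHS](modnMm (i`! * _)) ci cki modnMm modnMmr !muln1.
transitivity ((k`! * ifact q k) * (ifact q (k - i) * ifact q i) %% q)%N.
  by congr (_ %% _)%N; rewrite -bf; nia.
by rewrite -modnMml ck modnMml mul1n.
Qed.

(** Cauchy product of two exponential series, for any family [f]: since [f] vanishes for
    [i + m > n], the triangle and the full square have the same sum. *)
Lemma exp_reindex (f : nat -> nat -> M) :
  (forall i m, (n < i + m)%N -> f i m = 0) ->
  \sum_(k < n.+1) (\sum_(m < k.+1) f (k - m)%N m *+ 'C(k, m)) *+ ifact q k =
  \sum_(i < n.+1) \sum_(m < n.+1) f i m *+ ifact q m *+ ifact q i.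
Proof.
move=> f0.
transitivity (\sum_(k < n.+1) \sum_(m < n.+1 | (m <= k)%N)
   f (k - m)%N m *+ ifact q m *+ ifact q (k - m)).
  apply: eq_bigr => k _; rewrite -sumrMnl.
  rewrite (big_ord_widen_cond n.+1 xpredT (fun m => f (k - m)%N m *+ 'C(k, m) *+ ifact q k)) //=.
  apply: eq_big => [m|m]; first by rewrite ltnS.
  rewrite ltnS => mk; rewrite -!mulrnA; apply: mulrn_eqmod.
  rewrite mulnC ifact_bin ?[(ifact q m * _)%N]mulnC //.
  by rewrite -ltnS ltn_ord.
rewrite (exchange_big_dep xpredT) //= [RHS]exchange_big /=; apply: eq_bigr => m _.
pose F i := f i m *+ ifact q m *+ ifact q i.
have e1 : \sum_(k < n.+1 | (m <= k)%N) F (k - m)%N = \sum_(0 <= i < n.+1 - m) F i.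
  transitivity (\sum_(m <= k < n.+1) F (k - m)%N).
    by rewrite big_geq_mkord.
  rewrite -{1}[val m]add0n big_addn; apply: eq_bigr => i _.
  by rewrite addnK.
rewrite e1 -(big_mkord xpredT F) [RHS](@big_cat_nat _ _ _ (n.+1 - m)%N) //=; last by lia.
rewrite [X in _ + X]big_nat_cond [X in _ + X]big1 ?addr0 //.
by move=> i /andP[/andP[h1 h2] _]; rewrite /F f0 ?mul0rn //; lia.
Qed.
End Torsion.

(** * Multiplication rules for the truncated exponential *)

Section Exp.
Variables (q n : nat).

Definition rexp (R : pzRingType) (x : R) : R := \sum_(j < n.+1) x ^+ j *+ ifact q j.

Variable R : pzRingType.
Hypothesis tor : forall x : R, x *+ q = 0.
Hypothesis cop : factorials_coprime q n.
Implicit Types x y z w : R.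

Lemma mulrn_ifact0 x : x *+ ifact q 0 = x.
Proof. by rewrite -[RHS](mulrn_ifact tor cop _ (leq0n n)). Qed.

Lemma mulrn_ifact1 x : x *+ ifact q 1 = x.
Proof.
rewrite -[RHS]mulr1n; apply: (mulrn_eqmod tor).
have /invmodP e : (0 < 1)%N by [].
by rewrite -[RHS](e q) ?mul1n // coprime1n.
Qed.

Lemma rexp0 : rexp 0 = 1 :> R.
Proof.
rewrite /rexp big_ord_recl expr0 mulrn_ifact0 big1 ?addr0 // => i _.
by rewrite expr0n /= mul0rn.
Qed.

Lemma rexp_oppK x : (forall j, (n < j)%N -> x ^+ j = 0) -> rexp (- x) * rexp x = 1.
Proof.
move=> x0.
transitivity (rexp (- x + x)); last by rewrite addNr rexp0.
have cx : GRing.comm (- x) x by rewrite /GRing.comm mulNr mulrN.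
symmetry; rewrite /rexp; under eq_bigr => k _ do rewrite (exprDn_comm _ cx).
rewrite (@exp_reindex q n R tor cop (fun i m => (- x) ^+ i * x ^+ m)); last first.
  move=> i m h; rewrite exprNn -mulrA -exprD x0 // mulr0 //.
rewrite mulr_suml; apply: eq_bigr => i _; rewrite mulr_sumr; apply: eq_bigr => m _.
by rewrite mulrnAl mulrnAr.
Qed.

Definition adl z w := z * w - w * z.

Lemma iter_adl_comm z w j : iter j (adl z) (adl z w) = adl z (iter j (adl z) w).
Proof. by rewrite -iterS iterSr. Qed.

(** Binomial expansion of the [j]-th power of right multiplication by [z]; Pascal's rule merges the
    two sums of the induction. *)
Lemma mul_exp_ad w z j : w * z ^+ j =
  \sum_(m < j.+1) z ^+ (j - m) * ((-1) ^+ m * iter m (adl z) w) *+ 'C(j, m).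
Proof.
elim: j w => [|j IH] w; first by rewrite big_ord1 /= !mulr1 !mul1r.
(* One [z] crosses [w] and leaves a bracket, so the induction hypothesis is used for both [w] and
   [adl z w]. *)
have -> : w * z ^+ j.+1 = z * (w * z ^+ j) + (- adl z w) * z ^+ j.
  by rewrite /adl exprS mulNr mulrBl opprB !mulrA addrCA subrr addr0.
rewrite mulNr !IH big_ord_recl [in RHS]big_ord_recl !subn0 !bin0 !mulr1n mul1r /=.
rewrite mulrDr !mulrA -exprS -addrA; congr (_ + _).
rewrite mulr_sumr /= [in RHS]big_ord_recr [X in _ - X]big_ord_recr /= opprD addrA; congr (_ + _).
  rewrite -sumrB; apply: eq_bigr => i _; rewrite /bump !add1n.
  rewrite binS mulrnDr mulrnAr; congr (_ + _).
    rewrite subSS; have -> : (j - i = (j - i.+1).+1)%N by have := ltn_ord i; lia.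
    by rewrite mulrA -exprS.
  rewrite subSS -mulNrn; congr (_ *+ _).
  by rewrite exprS mulN1r iter_adl_comm !mulNr mulrN.
rewrite /bump !add1n !subnn !binn !mulr1n.
by rewrite exprS mulN1r iter_adl_comm !mulNr mulrN.
Qed.

(* [R_z = L_z - ad_z] with commuting summands. *)
Lemma mul_rexp w z :
  (forall i m, (n < i + m)%N -> z ^+ i * iter m (adl z) w = 0) ->
  w * rexp z = rexp z * \sum_(m < n.+1) ((-1) ^+ m * iter m (adl z) w) *+ ifact q m.
Proof.
move=> z0; rewrite mulr_sumr.
under eq_bigr => k _ do rewrite mulrnAr mul_exp_ad.
rewrite (@exp_reindex q n R tor cop
  (fun i m => z ^+ i * ((-1) ^+ m * iter m (adl z) w))); last first.
  by move=> i m h; rewrite mulrA -mulrA -signr_odd; case: (odd m); rewrite /= ?expr0 ?expr1 ?mul1r ?mulN1r ?mulrN z0 ?oppr0.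
rewrite mulr_suml; apply: eq_bigr => i _; rewrite mulr_sumr; apply: eq_bigr => m _.
by rewrite mulrnAl mulrnAr.
Qed.

Section Derivation.
Variable D : R -> R.
Hypothesis D0 : D 0 = 0.
Hypothesis DD : forall x y, D (x + y) = D x + D y.
Hypothesis DM : forall x y, D (x * y) = D x * y + x * D y.

Lemma D1 : D 1 = 0.
Proof. by apply: (addIr (D 1)); rewrite add0r -{3}[1]mulr1 DM mulr1 mul1r. Qed.

Lemma DMn x k : D (x *+ k) = D x *+ k.
Proof. by elim: k => [|k IH]; rewrite ?mulr0n // !mulrS DD IH. Qed.

Lemma Dsum (I : finType) (F : I -> R) : D (\sum_i F i) = \sum_i D (F i).
Proof. by apply: (big_morph D). Qed.

(** Weighted by 1/m!, these are the terms of (1 - e^(-ad z)) / ad z applied to [D z]; the index is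
    shifted by one to make the weights fit [exp_reindex]. *)
Definition dexp_coef z (m : nat) : R :=
  if m is m'.+1 then (-1) ^+ m' * iter m' (adl z) (D z) else 0.

Lemma D_exp z k :
  D (z ^+ k) = \sum_(m < k.+1) z ^+ (k - m) * dexp_coef z m *+ 'C(k, m).
Proof.
elim: k => [|k IH]; first by rewrite big_ord1 mulr0 mul0rn expr0 D1.
rewrite exprS DM {}IH mulr_sumr.
rewrite [in X in _ + X]big_ord_recl [in RHS]big_ord_recl /= !mulr0 !mul0rn mulr0 !add0r mul_exp_ad.
rewrite [RHS](eq_bigr (fun i : 'I_k.+1 => z ^+ (k - i) * ((-1) ^+ i * iter i (adl z) (D z)) *+ 'C(k, i)
   + z ^+ (k - i) * ((-1) ^+ i * iter i (adl z) (D z)) *+ 'C(k, i.+1))); last first.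
  by move=> i _; rewrite /bump !add1n subSS -mulrnDr [('C(k, _) + _)%N]addnC -binS.
rewrite big_split /=; congr (_ + _).
rewrite [RHS]big_ord_recr /= bin_small // mulr0n addr0; apply: eq_bigr => i _.
rewrite /bump !add1n mulrnAr mulrA -exprS.
by have -> : ((k - i.+1).+1 = k - i)%N by have := ltn_ord i; lia.
Qed.

(** The differential of the exponential. The bound is [n <= i + m] because the coefficient of index
    [m.+1] contains only [m] brackets. *)
Lemma D_rexp z :
  (forall i m, (n <= i + m)%N -> z ^+ i * iter m (adl z) (D z) = 0) ->
  D (rexp z) = rexp z * \sum_(m < n.+1) dexp_coef z m *+ ifact q m.
Proof.
move=> z0; rewrite Dsum.
under eq_bigr => k _ do rewrite DMn D_exp.
rewrite (@exp_reindex q n R tor cop (fun i m => z ^+ i * dexp_coef z m)); last first.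
  move=> i [|m] h; rewrite /= ?mulr0 //.
  by rewrite mulrA -mulrA -signr_odd; case: (odd m);
    rewrite /= ?expr0 ?expr1 ?mul1r ?mulN1r ?mulrN z0 ?oppr0 //; lia.
rewrite mulr_suml; apply: eq_bigr => i _; rewrite mulr_sumr; apply: eq_bigr => m _.
by rewrite mulrnAl mulrnAr.
Qed.
End Derivation.
End Exp.

(** * Additive subgroups as predicates *)

Definition subgroup (M : zmodType) (T : M -> Prop) :=
  T 0 /\ forall x y, T x -> T y -> T (x - y).

Section Subgroup.
Variables (M : zmodType) (T : M -> Prop).
Hypothesis sT : subgroup T.

Lemma subgroup0 : T 0. Proof. exact: sT.1. Qed.

Lemma subgroupB x y : T x -> T y -> T (x - y). Proof. exact: sT.2. Qed.

Lemma subgroupN x : T x -> T (- x).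
Proof. by move=> Tx; rewrite -sub0r; apply: subgroupB => //; apply: subgroup0. Qed.

Lemma subgroupD x y : T x -> T y -> T (x + y).
Proof. by move=> Tx Ty; rewrite -[y]opprK; apply/subgroupB/subgroupN. Qed.

Lemma subgroupMn x k : T x -> T (x *+ k).
Proof.
by move=> Tx; elim: k => [|k IH]; rewrite ?mulr0n ?mulrS;
  [apply: subgroup0 | apply: subgroupD].
Qed.

Lemma subgroup_sum (I : Type) (r : seq I) (Q : pred I) F :
  (forall i, Q i -> T (F i)) -> T (\sum_(i <- r | Q i) F i).
Proof. by move=> TF; apply: big_ind => //; [apply: subgroup0 | apply: subgroupD]. Qed.

End Subgroup.

Lemma subgroup_sign (R : pzRingType) (T : R -> Prop) k x :
  subgroup T -> T x -> T ((-1) ^+ k * x).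
Proof.
move=> sT Tx; rewrite -signr_odd; case: (odd k); rewrite ?expr0 ?expr1 ?mul1r ?mulN1r //.
exact: subgroupN.
Qed.

(** * Recovering an element from its exponential *)

Section Log.
Variables (q n : nat) (R : pzRingType).
Hypothesis tor : forall x : R, x *+ q = 0.
Hypothesis cop : factorials_coprime q n.
Local Notation exp := (rexp q n).

Lemma rexp_split (x : R) :
  exp x - 1 = x * \sum_(j < n) x ^+ j *+ ifact q j.+1.
Proof.
rewrite /rexp big_ord_recl expr0 (mulrn_ifact0 tor cop) addrC addKr mulr_sumr.
by apply: eq_bigr => j _; rewrite lift0 exprS mulrnAr.
Qed.

(* Replaces the logarithm series: descending induction on the total degree of
   the monomials [(exp x - 1) ^+ k * x ^+ i]. *)
Lemma log_mem (T : R -> Prop) (x : R) : subgroup T ->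
  (forall j, (n < j)%N -> x ^+ j = 0) ->
  (forall k, (0 < k)%N -> T ((exp x - 1) ^+ k)) ->
  forall k, (0 < k)%N -> T (x ^+ k).
Proof.
move=> sT x0 Tk.
set E := exp x - 1 in Tk *; set r := \sum_(j < n) x ^+ j *+ ifact q j.+1.
have defE : E = x * r := rexp_split x.
have cxr : GRing.comm x r.
  by apply: commr_sum => j _; apply/commrMn/commrX/commr_refl.
have E0 k i : (n < k + i)%N -> E ^+ k * x ^+ i = 0.
  move=> h; rewrite defE exprMn_comm // -mulrA.
  have -> : r ^+ k * x ^+ i = x ^+ i * r ^+ k.
    by apply/commr_sym/commrX/commr_sym/commrX.
  by rewrite mulrA -exprD x0 // mul0r.
(* [d] is the total degree and [e] bounds how far it lies below [n]; the inner induction trades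
   factors [E] for [x] one at a time. *)
suff main e d : (n < d + e)%N -> (0 < d)%N ->
    forall i, (i <= d)%N -> T (E ^+ (d - i) * x ^+ i).
  move=> k k0; have := main n.+1 k _ k0 k (leqnn k).
  by rewrite subnn expr0 mul1r; apply; lia.
elim: e d => [|e IHe] d hd d0.
  by move=> i id; rewrite E0 ?subnK //; [apply: subgroup0 | lia].
elim=> [_|i IHi id]; first by rewrite subn0 mulr1; apply: Tk.
have n0 : n = n.-1.+1 \/ (n < d)%N by lia.
case: n0 => [en|nd]; last by rewrite E0 ?subnK //; apply: subgroup0.
have := IHi (ltnW id); have -> : (d - i = (d - i.+1).+1)%N by lia.
(* [E] is [x] plus terms of degree at least two, so each trade leaves an error of higher total
   degree, covered by [IHe]. *)
rewrite exprSr -mulrA {2}defE /r en big_ord_recl /= expr0.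
rewrite (mulrn_ifact1 tor) mulrDr mulr1 mulrDl -exprS mulrDr.
set y := _ * _ ^+ _; set z := _ * _ => Tyz.
rewrite -[y](addrK z); apply: subgroupB => //; rewrite /z.
rewrite mulr_sumr mulr_suml mulr_sumr; apply: subgroup_sum => // j _.
rewrite /bump !add1n 2!(mulrnAr, mulrnAl) mulrnAr; apply: subgroupMn => //.
rewrite -exprS -exprD.
have Tj : (j.+2 + i <= d - i.+1 + (j.+2 + i))%N by lia.
have := IHe (d - i.+1 + (j.+2 + i))%N _ _ (j.+2 + i)%N Tj.
by rewrite addnK; apply; lia.
Qed.

End Log.

(** In [R * R] the diagonal contains the positive powers of [exp (x, y) - 1], hence by [log_mem] the
    pair [(x, y)] itself. This handles [x] and [y] that do not commute. *)
Lemma rexp_inj (q n : nat) (R : nzRingType) (x y : R) :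
  (forall z : R, z *+ q = 0) -> factorials_coprime q n ->
  (forall j, (n < j)%N -> x ^+ j = 0) -> (forall j, (n < j)%N -> y ^+ j = 0) ->
  rexp q n x = rexp q n y -> x = y.
Proof.
move=> tor cop x0 y0 exy.
pose T (z : R * R) := z.1 = z.2.
have sT : subgroup T by split=> // -[a b] [c d]; rewrite /T /= => -> ->.
have X1 (z : R * R) k : (z ^+ k).1 = z.1 ^+ k by elim: k => //= k IH; rewrite !exprS /= IH.
have X2 (z : R * R) k : (z ^+ k).2 = z.2 ^+ k by elim: k => //= k IH; rewrite !exprS /= IH.
have pairE (z : R * R) : z = (z.1, z.2) by case: z.
have Mn (z : R * R) k : z *+ k = (z.1 *+ k, z.2 *+ k).
  by elim: k => // k IH; rewrite !mulrS IH.
have := @log_mem q n (R * R)%type _ cop T (x, y) sT _ _ 1%N; apply=> //.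
- by move=> z; rewrite Mn !tor.
- by move=> j nj; rewrite [LHS]pairE X1 X2 /= x0 // y0.
have expE : rexp q n ((x, y) : R * R) = (rexp q n x, rexp q n y).
  rewrite [LHS]pairE /rexp; congr (_, _).
    rewrite (big_morph (fun z : R * R => z.1) (op1 := +%R) (id1 := 0)) //.
    by apply: eq_bigr => j _; rewrite Mn /= X1.
  rewrite (big_morph (fun z : R * R => z.2) (op1 := +%R) (id1 := 0)) //.
  by apply: eq_bigr => j _; rewrite Mn /= X2.
by move=> k _; rewrite /T X1 X2 /= expE /= exy.
Qed.

(** * Baker-Campbell-Hausdorff *)

Section Order.
Variable R : nzRingType.
Implicit Types f g : {poly R}.

Definition order_ge (j : nat) f := forall k, (k < j)%N -> f`_k = 0.

Lemma order_ge_subgroup j : subgroup (order_ge j).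
Proof.
by split=> [k _|f g f0 g0 k kj]; rewrite ?coef0 // coefB f0 // g0 // subr0.
Qed.

Lemma order_geW i j f : (i <= j)%N -> order_ge j f -> order_ge i f.
Proof. by move=> ij f0 k ki; apply: f0; apply: leq_trans ij. Qed.

Lemma order_geM i j f g : order_ge i f -> order_ge j g -> order_ge (i + j) (f * g).
Proof.
move=> f0 g0 k kij; rewrite coefM big1 // => a _.
have [ai|ia] := ltnP a i; first by rewrite f0 // mul0r.
by rewrite g0 ?mulr0 //; have := ltn_ord a; lia.
Qed.

Lemma coef_order_ge1 f : order_ge 1 f <-> f`_0 = 0.
Proof. by split=> [-> //|f0 [] //]. Qed.

Lemma order_geX k f : order_ge 1 f -> order_ge k (f ^+ k).
Proof.
by move=> f1; elim: k => [//|k IH]; rewrite exprS -add1n; apply: order_geM.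
Qed.

(** Serves to read the lowest coefficient of [u - w] off [exp Z * (u - w)]: a factor with constant
    term 1 preserves lowest terms. *)
Lemma coef_mul_unipotent f g j : f`_0 = 1 -> order_ge j (f * g) ->
  order_ge j g /\ (f * g)`_j = g`_j.
Proof.
move=> f1 fg0.
have coefE k : order_ge k g -> (f * g)`_k = g`_k.
  move=> g0; rewrite coefM big_ord_recl subn0 f1 mul1r big1 ?addr0 // => i _.
  by rewrite g0 ?mulr0 // lift0; have := ltn_ord i; lia.
suff g0 : order_ge j g by split=> //; apply: coefE.
elim: j fg0 => [//|j IH] fg0 k; rewrite ltnS leq_eqVlt => /orP[/eqP->|kj].
  by rewrite -coefE ?fg0 //; apply/IH/(order_geW (leqnSn j)).
by apply: IH => //; apply/(order_geW (leqnSn j)).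
Qed.

Definition euler f : {poly R} := 'X * f^`().

Lemma coef_euler f k : (euler f)`_k = f`_k *+ k.
Proof. by rewrite coefXM; case: k => [|k] //=; rewrite coef_deriv. Qed.

Lemma euler0 : euler 0 = 0. Proof. by rewrite /euler deriv0 mulr0. Qed.

Lemma eulerD f g : euler (f + g) = euler f + euler g.
Proof. by rewrite /euler derivD mulrDr. Qed.

Lemma eulerM f g : euler (f * g) = euler f * g + f * euler g.
Proof. by rewrite /euler derivM mulrDr !mulrA [f * 'X]commr_polyX. Qed.
End Order.

(** * Products of exponentials in a ring with a nilpotent filtration *)

Section BCH.
Variables (q n : nat) (R : nzRingType).
Hypothesis tor : forall x : R, x *+ q = 0.
Hypothesis cop : factorials_coprime q n.
Local Notation exp := (rexp q n).

Variables (P : nat -> R -> Prop) (Lie : R -> Prop).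
Hypothesis sP : forall k, subgroup (P k).
Hypothesis P_1 : P 0 1.
Hypothesis P_M : forall i j x y, P i x -> P j y -> P (i + j) (x * y).
Hypothesis P_nil : forall k x, (n < k)%N -> P k x -> x = 0.
Hypothesis sL : subgroup Lie.
Hypothesis L_br : forall x y, Lie x -> Lie y -> Lie (x * y - y * x).
Implicit Types f g u w Z : {poly R}.

Let torp f : f *+ q = 0.
Proof. by apply/polyP => i; rewrite coefMn coef0 tor. Qed.

(** Degree in the variable is tied to the filtration [P], so order above [n] forces a polynomial to
    vanish and only degrees up to [n] need comparing. *)
Definition fil (j : nat) f := (forall k, P k f`_k) /\ order_ge j f.

Lemma fil_subgroup j : subgroup (fil j).
Proof.
split=> [|f g [Pf f0] [Pg g0]]; split.
- by move=> k; rewrite coef0; apply: subgroup0.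
- by case: (order_ge_subgroup R j).
- by move=> k; rewrite coefB; apply: subgroupB.
- exact: subgroupB (order_ge_subgroup R j) _ _ _ _.
Qed.

Lemma filW i j f : (i <= j)%N -> fil j f -> fil i f.
Proof. by move=> ij [Pf f0]; split=> //; apply: order_geW ij f0. Qed.

Lemma filM i j f g : fil i f -> fil j g -> fil (i + j) (f * g).
Proof.
move=> [Pf f0] [Pg g0]; split; last exact: order_geM.
move=> k; rewrite coefM; apply: subgroup_sum => // a _.
have {1}-> : k = (a + (k - a))%N by rewrite subnKC // -ltnS.
exact: P_M.
Qed.

Lemma fil1 : fil 0 1.
Proof.
by split=> // k; rewrite coef1; case: k => //= k; apply: subgroup0.
Qed.

Lemma filX k f : fil 1 f -> fil k (f ^+ k).
Proof. by move=> f1; elim: k => [|k IH]; [apply: fil1 | rewrite exprS -add1n; apply: filM]. Qed.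

Lemma fil_eq0 j f : (n < j)%N -> fil j f -> f = 0.
Proof.
move=> nj [Pf f0]; apply/polyP => k; rewrite coef0.
by have [/f0 //|jk] := ltnP k j; apply: P_nil (Pf k); lia.
Qed.

Lemma fil_exp f : fil 1 f -> fil 0 (exp f).
Proof.
move=> f1; apply: subgroup_sum => [|i _]; first exact: fil_subgroup.
by apply: subgroupMn; [apply: fil_subgroup | apply/(filW (leq0n i))/filX].
Qed.

Lemma coef0_exp f : fil 1 f -> (exp f)`_0 = 1.
Proof.
move=> f1; rewrite /rexp big_ord_recl expr0 (mulrn_ifact0 torp cop) coefD coef1.
rewrite coef_sum big1 ?addr0 // => i _; rewrite lift0 coefMn.
by have [_ ->] := filX i.+1 f1; rewrite // mul0rn.
Qed.

Definition lie_poly f := fil 1 f /\ forall k, Lie f`_k.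

Lemma lie_poly_subgroup : subgroup lie_poly.
Proof.
split=> [|f g [f1 Lf] [g1 Lg]]; split.
- exact: subgroup0 (fil_subgroup 1).
- by move=> k; rewrite coef0; apply: subgroup0.
- exact: subgroupB (fil_subgroup 1) _ _ _ _.
- by move=> k; rewrite coefB; apply: subgroupB.
Qed.

Lemma lie_poly_adl f g : lie_poly f -> lie_poly g -> lie_poly (adl f g).
Proof.
move=> [f1 Lf] [g1 Lg]; split.
  by apply: subgroupB; [apply: fil_subgroup | |]; apply: (@filW 1 (1 + 1)) => //; apply: filM.
(* [coefMr] reverses the second convolution, so the two sums pair off into brackets of
   coefficients. *)
move=> k; rewrite coefB coefM coefMr -sumrB; apply: subgroup_sum => // i _.
exact: L_br.
Qed.

Lemma lie_poly_iter f g k : lie_poly f -> lie_poly g -> lie_poly (iter k (adl f) g).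
Proof. by move=> Lf Lg; elim: k => //= k IH; apply: lie_poly_adl. Qed.

Lemma lie_poly_euler f : lie_poly f -> lie_poly (euler f).
Proof.
move=> [[Pf f0] Lf]; split; [split|] => k; rewrite coef_euler.
- exact: subgroupMn.
- by move=> k1; rewrite f0 // mul0rn.
- exact: subgroupMn.
Qed.

Lemma fil_iter_adl f g m : fil 1 f -> fil 1 g -> fil m.+1 (iter m (adl f) g).
Proof.
move=> f1 g1; elim: m => //= m IH; apply: subgroupB; first exact: fil_subgroup.
  by rewrite -[m.+2]add1n; apply: filM.
by rewrite -[m.+2]addn1; apply: filM.
Qed.

Lemma mul_iter_adl_eq0 f g i m : fil 1 f -> fil 1 g -> (n <= i + m)%N ->
  f ^+ i * iter m (adl f) g = 0.
Proof.
move=> f1 g1 h; apply: (@fil_eq0 (i + m.+1)); first by lia.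
by apply: filM; [apply: filX | apply: fil_iter_adl].
Qed.

Lemma lie_poly_series (c : nat -> {poly R}) :
  (forall m, lie_poly (c m)) -> lie_poly (\sum_(m < n.+1) c m *+ ifact q m).
Proof.
move=> Lc; apply: subgroup_sum => [|m _]; first exact: lie_poly_subgroup.
by apply: subgroupMn; first exact: lie_poly_subgroup.
Qed.

Lemma euler_exp Z : lie_poly Z -> exists2 w, lie_poly w & euler (exp Z) = exp Z * w.
Proof.
move=> LZ; have LD := lie_poly_euler LZ.
exists (\sum_(m < n.+1) dexp_coef (@euler R) Z m *+ ifact q m).
  apply: lie_poly_series => -[|m] /=; first exact: subgroup0 lie_poly_subgroup.
  by apply: subgroup_sign; [apply: lie_poly_subgroup | apply: lie_poly_iter].
apply: (@D_rexp q n _ torp cop (@euler R)); rewrite ?euler0 //.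
- exact: eulerD.
- exact: eulerM.
by move=> i m h; apply: mul_iter_adl_eq0 => //; [case: LZ | case: LD].
Qed.

(** In the Leibniz expansion, moving the factor [u] of [exp X] across [exp Y] turns it into e^(-ad
    Y) applied to [u], again a Lie polynomial. *)
Lemma euler_exp_mul X Y : lie_poly X -> lie_poly Y ->
  exists2 u, lie_poly u & euler (exp X * exp Y) = exp X * exp Y * u.
Proof.
move=> LX LY; have [u Lu eu] := euler_exp LX; have [v Lv ev] := euler_exp LY.
pose s := \sum_(m < n.+1) ((-1) ^+ m * iter m (adl Y) u) *+ ifact q m.
exists (s + v).
  apply: subgroupD => //; first exact: lie_poly_subgroup.
  apply: (@lie_poly_series (fun m => (-1) ^+ m * iter m (adl Y) u)) => m.
  by apply: subgroup_sign; [apply: lie_poly_subgroup | apply: lie_poly_iter].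
rewrite eulerM eu ev mulrDr !mulrA; congr (_ + _).
rewrite -!mulrA; congr (_ * _); apply: (mul_rexp torp cop) => i m h.
by apply: mul_iter_adl_eq0; [case: LY | case: Lu | lia].
Qed.

(** A noncommutative telescoping: each summand has a factor of order [k.+1] and at least one more
    factor of order 1. *)
Lemma order_ge_pow_sub f g k : order_ge 1 f -> order_ge 1 g ->
  order_ge k.+1 (g - f) -> forall j, order_ge k.+2 (g ^+ j.+2 - f ^+ j.+2).
Proof.
move=> f1 g1 fg.
have step i : order_ge k.+1 (g ^+ i.+1 - f ^+ i.+1) -> order_ge k.+2 (g ^+ i.+2 - f ^+ i.+2).
  move=> h; rewrite (_ : _ - _ = g ^+ i.+1 * (g - f) + (g ^+ i.+1 - f ^+ i.+1) * f).
    apply: (subgroupD (order_ge_subgroup _ _)).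
      apply: (@order_geW _ _ (i.+1 + k.+1)); first by lia.
      by apply: order_geM; [apply: order_geX | ].
    by rewrite -[k.+2]addn1; apply: order_geM.
  by rewrite mulrBr mulrBl addrA subrK -!exprSr.
elim=> [|j IH]; first by apply: step; rewrite !expr1.
by apply: step; apply: order_geW IH.
Qed.

(** Only the linear term of the exponential sees the monomial in degree [k.+1]; by
    [order_ge_pow_sub] the higher powers change in order [k.+2] only. *)
Lemma exp_add_monomial Z k d : fil 1 Z -> (k < n)%N ->
  order_ge k.+2 (exp (Z + d *: 'X^(k.+1)) - (exp Z + d *: 'X^(k.+1))).
Proof.
move=> [_ Z1] kn; set Y := d *: _.
have Y0 : order_ge k.+1 Y.
  by move=> i ik; rewrite coefZ coefXn ltn_eqF // mulr0.
have ZY1 : order_ge 1 (Z + Y).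
  by apply: (subgroupD (order_ge_subgroup _ _)) => //; apply: order_geW Y0.
have -> : n = n.-1.+1 by lia.
rewrite /rexp !big_ord_recl !lift0 !expr0 !expr1.
rewrite !(mulrn_ifact1 torp).
set a : {poly R} := 1; set S := \sum_(i < _) _; set S' := \sum_(i < _) _.
have -> : a + (Z + Y + S) - (a + (Z + S') + Y) = S - S'.
  rewrite -!addrA [S' + Y]addrC !addrA; set x := a + Z + Y.
  by rewrite opprD addrACA subrr add0r.
rewrite /S /S' -sumrB.
apply: (subgroup_sum (order_ge_subgroup _ _)) => j _.
rewrite -mulrnBl; apply: (subgroupMn (order_ge_subgroup _ _)).
by rewrite !lift0; apply: order_ge_pow_sub => //; rewrite addrC addKr.
Qed.

Lemma bch_poly X Y : lie_poly X -> lie_poly Y ->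
  exists2 Z, lie_poly Z & exp X * exp Y = exp Z.
Proof.
move=> LX LY; set g := exp X * exp Y.
have fg : fil 0 g by apply: (@filM 0 0); apply: fil_exp; [case: LX | case: LY].
have g1 : g`_0 = 1.
  by rewrite coefM big_ord1 !coef0_exp ?mulr1 //; [case: LY | case: LX].
suff [Z LZ Zg] : exists2 Z, lie_poly Z & order_ge n.+1 (g - exp Z).
  exists Z => //; apply/eqP; rewrite -subr_eq0; apply/eqP.
  apply: (@fil_eq0 n.+1) => //; split=> // k.
  rewrite coefB; apply: subgroupB => //; first by case: fg.
  by case: (@fil_exp Z) => //; case: LZ.
have [u Lu Dg] := euler_exp_mul LX LY.
suff main k : (k <= n)%N -> exists2 Z, lie_poly Z & order_ge k.+1 (g - exp Z) by exact: main.
elim: k => [_|k IH kn].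
  exists 0; first exact: subgroup0 lie_poly_subgroup.
  by apply/coef_order_ge1; rewrite (rexp0 torp cop) coefB g1 coef1 subrr.
have {IH} [|Z LZ Zg] := IH; first exact: ltnW.
have [w Lw Dw] := euler_exp LZ.
(* The defect in the next degree is the correction to add to [Z]; what remains is that it is Lie. *)
set d := (g - exp Z)`_k.+1.
have Pd : P k.+1 d.
  rewrite /d coefB; apply: subgroupB => //; first by case: fg.
  by case: (@fil_exp Z) => //; case: LZ.
(* The difference is [(g - exp Z) * u], a product of factors of orders [k.+1] and 1. *)
have hD : order_ge k.+2 (euler (g - exp Z) - exp Z * (u - w)).
  have -> : euler (g - exp Z) = g * u - exp Z * w.
    by have := eulerD (g - exp Z) (exp Z); rewrite subrK Dg Dw => ->; rewrite addrK.
  rewrite mulrBr opprB addrA subrK -mulrBl -[k.+2]addn1.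
  by apply: order_geM => //; case: Lu => -[].
have coefDu i : (i < k.+2)%N -> (exp Z * (u - w))`_i = (g - exp Z)`_i *+ i.
  move=> ik; rewrite -coef_euler; apply/esym/eqP.
  by rewrite -subr_eq0 -coefB hD.
have [||_ uwd] := @coef_mul_unipotent R (exp Z) (u - w) k.+1.
- by apply: coef0_exp; case: LZ.
- by move=> i ik; rewrite coefDu ?Zg ?mul0rn // ltnW.
have Ld : Lie d.
  (* Splitting [k.+1] off the factorial writes [d] as a multiple of [d *+ k.+1], which is a
     coefficient of [u - w]. *)
  rewrite -(mulrn_ifact tor cop d kn) factS mulrnA.
  do 2![apply: subgroupMn => //].
  by rewrite -coefDu // uwd coefB; apply: subgroupB; [|case: Lu|case: Lw].
exists (Z + d *: 'X^(k.+1)).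
  apply: subgroupD => //; first exact: lie_poly_subgroup.
  split; [split|] => i; rewrite coefZ coefXn.
  - by case: eqP => [->|_]; rewrite ?mulr1 ?mulr0 //; apply: subgroup0.
  - by case: i => // _; rewrite mulr0.
  - by case: eqP => _; rewrite ?mulr1 ?mulr0 //; apply: subgroup0.
have ZY := @exp_add_monomial Z k d LZ.1 kn.
move=> i ik; have := ZY i ik; rewrite !coefB coefD.
rewrite coefZ coefXn => /eqP; rewrite subr_eq0 => /eqP ->.
move: ik; rewrite ltnS leq_eqVlt => /orP[/eqP->|ik].
  by rewrite eqxx mulr1 /d coefB opprD addrA subrr.
by rewrite ltn_eqF // mulr0 addr0 -coefB Zg.
Qed.

Lemma horner1_exp Z : (exp Z).[1] = exp Z.[1].
Proof.
rewrite /rexp horner_sum; apply: eq_bigr => i _.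
by rewrite hornerMn horner_exp_comm // /comm_poly mulr1 mul1r.
Qed.

(** Scaling [X] and [Y] by the variable gives polynomials of order 1; evaluating at 1, which is
    central, returns to [R]. *)
Lemma bch X Y : P 1 X -> Lie X -> P 1 Y -> Lie Y ->
  exists2 Z, Lie Z & exp X * exp Y = exp Z.
Proof.
have lieX x : P 1 x -> Lie x -> lie_poly (x *: 'X).
  move=> Px Lx; split; [split|] => i; rewrite coefZ coefX.
  - by case: eqP => [->|_]; rewrite ?mulr1 ?mulr0 //; apply: subgroup0.
  - by case: i => // _; rewrite mulr0.
  - by case: eqP => _; rewrite ?mulr1 ?mulr0 //; apply: subgroup0.
move=> PX LX PY LY; have [Z LZ e] := bch_poly (lieX _ PX LX) (lieX _ PY LY).
exists Z.[1].
  by rewrite horner_coef; apply: subgroup_sum => // i _; rewrite expr1n mulr1; case: LZ.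
have := congr1 (horner^~ 1) e; rewrite hornerM_comm; last by rewrite /comm_poly mulr1 mul1r.
by rewrite !horner1_exp !hornerZ hornerX !mulr1.
Qed.
End BCH.

(** * Endomorphisms of [A^id] *)

Section Endo.
Variable B : finZmodType.

Definition is_endo : {pred {ffun B -> B}} :=
  fun f => [forall x, forall y, f (x - y) == f x - f y].

Lemma is_endoP (f : {ffun B -> B}) :
  reflect (forall x y, f (x - y) = f x - f y) (f \in is_endo).
Proof.
by apply: (iffP forallP) => [h x y|h x]; [have /forallP/(_ y)/eqP := h x | apply/forallP => y; rewrite h].
Qed.

Lemma is_endo_zmod_closed : zmod_closed is_endo.
Proof.
split=> [|f g /is_endoP hf /is_endoP hg]; apply/is_endoP => x y; rewrite !ffunE ?subrr //.
by rewrite hf hg !opprB addrACA [RHS]addrACA [in RHS](addrC (- g x)).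
Qed.

HB.instance Definition _ := GRing.isZmodClosed.Build _ is_endo is_endo_zmod_closed.

(** Carved out of finite functions so that equality is pointwise; under composition this is the ring
    in which left multiplications live. *)
Record endo := Endo { endo_val :> {ffun B -> B}; _ : endo_val \in is_endo }.

HB.instance Definition _ := [isSub for endo_val].
HB.instance Definition _ := [Choice of endo by <:].
HB.instance Definition _ := [SubChoice_isSubZmodule of endo by <:].

Implicit Types f g : endo.

Lemma endoB f x y : f (x - y) = f x - f y.
Proof. by have /is_endoP := valP f. Qed.

Definition mk_endo (h : B -> B) (hB : forall x y, h (x - y) = h x - h y) : endo.
Proof. by apply: (@Endo (finfun h)); apply/is_endoP => x y; rewrite !ffunE. Defined.

Lemma mk_endoE h hB x : @mk_endo h hB x = h x.
Proof. by rewrite ffunE. Qed.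

Lemma endoP f g : (forall x, f x = g x) <-> f = g.
Proof. by split=> [e|-> //]; apply/val_inj/ffunP. Qed.

Lemma endo_addE f g x : (f + g) x = f x + g x.
Proof. by rewrite ffunE. Qed.

Fact id_endo_subproof (x y : B) : id (x - y) = id x - id y. Proof. by []. Qed.
Fact comp_endo_subproof f g x y : f (g (x - y)) = f (g x) - f (g y).
Proof. by rewrite !endoB. Qed.
Definition endo_one : endo := mk_endo id_endo_subproof.
Definition endo_mul f g : endo := mk_endo (comp_endo_subproof f g).

Lemma endo0 f : f 0 = 0.
Proof. by rewrite -{1}(subrr 0) endoB subrr. Qed.
Lemma endoN f x : f (- x) = - f x.
Proof. by rewrite -sub0r endoB endo0 sub0r. Qed.
Lemma endoD f x y : f (x + y) = f x + f y.
Proof. by rewrite -{1}[y]opprK endoB endoN opprK. Qed.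

Fact endo_mulA : associative endo_mul.
Proof. by move=> f g h; apply/endoP => x; rewrite /endo_mul !mk_endoE ?mk_endoE. Qed.
Fact endo_mul1 : left_id endo_one endo_mul.
Proof. by move=> f; apply/endoP => x; rewrite /endo_mul !mk_endoE ?mk_endoE. Qed.
Fact endo_mulr1 : right_id endo_one endo_mul.
Proof. by move=> f; apply/endoP => x; rewrite /endo_mul !mk_endoE ?mk_endoE. Qed.
Fact endo_mulDl : left_distributive endo_mul +%R.
Proof. by move=> f g h; apply/endoP => x; rewrite /endo_mul !(mk_endoE, endo_addE). Qed.
Fact endo_mulDr : right_distributive endo_mul +%R.
Proof. by move=> f g h; apply/endoP => x; rewrite /endo_mul !(mk_endoE, endo_addE) endoD. Qed.

HB.instance Definition _ := GRing.Zmodule_isPzRing.Build endo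
  endo_mulA endo_mul1 endo_mulr1 endo_mulDl endo_mulDr.

Lemma endo1E x : (1 : endo) x = x. Proof. exact: mk_endoE. Qed.
Lemma endoME f g x : (f * g) x = f (g x). Proof. exact: mk_endoE. Qed.
Lemma endo0E x : (0 : endo) x = 0. Proof. by rewrite ffunE. Qed.
Lemma endoBE f g x : (f - g) x = f x - g x. Proof. by rewrite !ffunE. Qed.
Lemma endoMnE f k x : (f *+ k) x = f x *+ k.
Proof. by elim: k => [|k IH]; rewrite ?endo0E // !mulrS endo_addE IH. Qed.
Lemma endoXE f k x : (f ^+ k) x = iter k f x.
Proof. by elim: k => [|k IH]; rewrite ?endo1E // exprS endoME IH. Qed.
Lemma endo_sumE (I : Type) (r : seq I) (F : I -> endo) x :
  (\sum_(i <- r) F i) x = \sum_(i <- r) F i x.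
Proof. by apply: (big_morph (fun f : endo => f x)) => [f g|]; rewrite ?endo_addE ?endo0E. Qed.
End Endo.

(* A finite stand-in for the paper's [A^id = A x Z]. *)
Definition unitization (A : finZmodType) (q0 : nat) : Type := (A * 'I_q0.+2)%type.

Section Unitization.
Variables (A : finZmodType) (q0 : nat).
Local Notation B := (unitization A q0).
HB.instance Definition _ := Finite.on B.
HB.instance Definition _ := GRing.Zmodule.on B.

(** Polynomials over [endo B] require a nonzero ring; the second factor of [B] has at least two
    elements, even if [A] is trivial. *)
Fact endo_unitization_neq0 : (1 : endo B) != 0.
Proof.
apply/eqP => /endoP/(_ (0, 1)); rewrite endo1E endo0E => /(congr1 snd) /= e.
by have := oner_neq0 'Z_q0.+2; rewrite e eqxx.
Qed.
HB.instance Definition _ := GRing.PzSemiRing_isNonZero.Build (endo B) endo_unitization_neq0.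

End Unitization.

(** * Additive spans and the left and right series *)

Lemma addspan_subgroup (A : finZmodType) (S : A -> Prop) : subgroup (addspan S).
Proof. by split=> [|x y]; [apply: addspan_0 | apply: addspan_sub]. Qed.

Lemma addspan_min (A : finZmodType) (S T : A -> Prop) :
  subgroup T -> (forall x, S x -> T x) -> forall x, addspan S x -> T x.
Proof.
by move=> sT ST x; elim=> [y /ST //||y z _ Ty _ Tz]; [apply: subgroup0 | apply: subgroupB].
Qed.

Lemma lpow_subgroup (A : finZmodType) (op : A -> A -> A) i : subgroup (lpow op i).
Proof. by case: i => [|[|i]] //; apply: addspan_subgroup. Qed.

Lemma rpow_subgroup (A : finZmodType) (op : A -> A -> A) i : subgroup (rpow op i).
Proof. by case: i => [|[|i]] //; apply: addspan_subgroup. Qed.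

Section Powers.
Variables (A : finZmodType) (op : A -> A -> A).

Lemma lpow_step i c x : (0 < i)%N -> lpow op i x -> lpow op i.+1 (op c x).
Proof. by case: i => // i _ hx; apply: addspan_gen; exists c, x. Qed.

Lemma rpow_step i c x : (0 < i)%N -> rpow op i c -> rpow op i.+1 (op c x).
Proof. by case: i => // i _ hc; apply: addspan_gen; exists c, x. Qed.

Lemma lpow_decr i x : lpow op i.+1 x -> lpow op i x.
Proof.
elim: i x => [//|[//|i] IH] x.
apply: addspan_min; first exact: addspan_subgroup.
by move=> _ [c [y [_ [/IH hy ->]]]]; apply: lpow_step.
Qed.

Lemma rpow_decr i x : rpow op i.+1 x -> rpow op i x.
Proof.
elim: i x => [//|[//|i] IH] x.
apply: addspan_min; first exact: addspan_subgroup.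
by move=> _ [c [y [/IH hc [_ ->]]]]; apply: rpow_step.
Qed.
End Powers.

(** * The group of flows *)

Section PreLie.
Variables (A : finZmodType) (q0 n : nat).
Local Notation q := q0.+2.
Local Notation B := (unitization A q0).
Hypothesis tor : forall x : A, x *+ q = 0.
Hypothesis cop : factorials_coprime q n.

Lemma divA_ifact j (x : A) : (j <= n)%N -> divA j`! x = x *+ ifact q j.
Proof.
move=> jn; rewrite /divA; case: pickP => [y /eqP <-|/(_ (x *+ ifact q j))] /=.
  by rewrite (mulrn_ifact tor cop).
by rewrite mulrnAC (mulrn_ifact tor cop) ?eqxx.
Qed.

Lemma tor_unitization (x : B) : x *+ q = 0.
Proof.
have Mn k : x *+ k = (x.1 *+ k, x.2 *+ k) by elim: k => // k IH; rewrite !mulrS IH.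
by rewrite Mn tor Zp_mulrn; congr (_, _); apply: val_inj; rewrite /= modnMl.
Qed.

Lemma tor_endo (f : endo B) : f *+ q = 0.
Proof. by apply/endoP => x; rewrite endoMnE endo0E tor_unitization. Qed.

Variable mul : A -> A -> A.
Hypothesis mul_prelie : prelie mul.
Hypothesis mul_nil : forall k x, (n < k)%N -> lpow mul k x -> x = 0.

Lemma mulDl x y z : mul (x + y) z = mul x z + mul y z.
Proof. by case: mul_prelie => h _ _; apply: h. Qed.
Lemma mulDr x y z : mul x (y + z) = mul x y + mul x z.
Proof. by case: mul_prelie => _ h _; apply: h. Qed.
Lemma mulx0 x : mul x 0 = 0.
Proof. by apply: (addIr (mul x 0)); rewrite -mulDr !add0r. Qed.
Lemma mulBl x y z : mul (x - y) z = mul x z - mul y z.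
Proof. by apply: (addIr (mul y z)); rewrite -mulDl !subrK. Qed.
Lemma mulBr x y z : mul x (y - z) = mul x y - mul x z.
Proof. by apply: (addIr (mul x z)); rewrite -mulDr !subrK. Qed.
Lemma mul_Mnr x y k : mul x (y *+ k) = mul x y *+ k.
Proof. by elim: k => [|k IH]; rewrite ?mulx0 // !mulrS mulDr IH. Qed.

(** Residues modulo [q] act on [A] because [q] kills it. *)
Lemma scaleB (c : A) (m m' : 'I_q) : c *+ (m - m')%R = c *+ m - c *+ m'.
Proof.
apply/eqP; rewrite eq_sym subr_eq -mulrnDr; apply/eqP.
apply: (mulrn_eqmod tor); rewrite -{1}[m](subrK m').
have e (a b : 'I_q) : (a + b)%R = ((a + b) %% q)%N :> nat by [].
by rewrite e modn_mod.
Qed.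

Fact lmul_subproof (c : A) (x y : B) :
  (mul c (x - y).1 + c *+ (x - y).2, 0) =
  (mul c x.1 + c *+ x.2, 0) - (mul c y.1 + c *+ y.2, 0) :> B.
Proof.
case: x y => [x m] [y m']; congr (_, _) => /=; last by rewrite subrr.
by rewrite mulBr scaleB opprD addrACA.
Qed.

(* The paper's [L_c] on [A^id]. *)
Definition lmul (c : A) : endo B :=
  @mk_endo B (fun x : B => (mul c x.1 + c *+ x.2, 0)) (lmul_subproof c).

Lemma lmulE c x m : lmul c (x, m) = (mul c x + c *+ m, 0).
Proof. exact: mk_endoE. Qed.

Lemma lmul_one c : lmul c (0, 1) = (c, 0).
Proof. by rewrite lmulE mulx0 add0r. Qed.

Lemma lmul_inj : injective lmul.
Proof. by move=> c d /endoP/(_ (0, 1)); rewrite !lmul_one => -[]. Qed.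

Lemma lmulB c d : lmul (c - d) = lmul c - lmul d.
Proof.
apply/endoP => -[x m]; rewrite endoBE !lmulE; congr (_, _); last by rewrite /= subrr.
by rewrite /= mulBl mulrnBl opprD addrACA.
Qed.

Lemma lmul0 : lmul 0 = 0.
Proof. by rewrite -(subrr 0) lmulB subrr. Qed.

Lemma lmulN c : lmul (- c) = - lmul c.
Proof. by rewrite -sub0r lmulB lmul0 sub0r. Qed.

(** On [A] this is the pre-Lie identity; on the unit [(0, 1)] both sides give the commutator of [c]
    and [d]. *)
Lemma lmul_br c d : lmul c * lmul d - lmul d * lmul c = lmul (mul c d - mul d c).
Proof.
apply/endoP => -[x m]; rewrite endoBE !endoME !lmulE; congr (_, _); last by rewrite /= subrr.
rewrite /= !addr0 !mulDr !mul_Mnr mulBl mulrnBl opprD addrACA; congr (_ + _).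
case: mul_prelie => _ _ /(_ c d x) e.
rewrite -[mul (mul c d) x](subrK (mul c (mul d x))) e.
by rewrite [RHS]addrAC [mul (mul d c) x - _ - _]addrAC subrr add0r addrC.
Qed.

Definition lie_lmul (f : endo B) := exists c, f = lmul c.

Lemma lie_lmul_subgroup : subgroup lie_lmul.
Proof.
split=> [|f g [c ->] [d ->]]; first by exists 0; rewrite lmul0.
by exists (c - d); rewrite lmulB.
Qed.

Lemma lie_lmul_br f g : lie_lmul f -> lie_lmul g -> lie_lmul (f * g - g * f).
Proof. by move=> [c ->] [d ->]; exists (mul c d - mul d c); rewrite lmul_br. Qed.

(** The premise makes [filt 0] all of [B], so that a left multiplication raises the level by one
    even on the unit. *)
Definition filt (i : nat) (x : B) := (0 < i)%N -> lpow mul i x.1 /\ x.2 = 0.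

Lemma filt_subgroup i : subgroup (filt i).
Proof.
split=> [_|x y hx hy i0]; first by split=> //; apply: subgroup0 (lpow_subgroup _ _).
have [x1 x2] := hx i0; have [y1 y2] := hy i0; split; last by rewrite /= x2 y2 subrr.
exact: (subgroupB (lpow_subgroup _ _)).
Qed.

Definition filt_shift (k : nat) (f : endo B) :=
  forall i x, filt i x -> filt (i + k) (f x).

Lemma filt_shift_subgroup k : subgroup (filt_shift k).
Proof.
split=> [i x _|f g hf hg i x hx].
  by rewrite endo0E; apply: subgroup0 (filt_subgroup _).
by rewrite endoBE; apply: (subgroupB (filt_subgroup _)); [apply: hf | apply: hg].
Qed.

Lemma filt_shift1 : filt_shift 0 1.
Proof. by move=> i x; rewrite addn0 endo1E. Qed.

Lemma filt_shiftM i j f g : filt_shift i f -> filt_shift j g -> filt_shift (i + j) (f * g).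
Proof.
by move=> hf hg k x hx; rewrite endoME [(i + j)%N]addnC addnA; apply/hf/hg.
Qed.

Lemma filt_shift_eq0 k f : (n < k)%N -> filt_shift k f -> f = 0.
Proof.
move=> nk hf; apply/endoP => x; rewrite endo0E.
have [||h1 h2] := hf 0%N x; [by [] | by lia |].
by rewrite [LHS]surjective_pairing h2 (mul_nil nk h1).
Qed.

Lemma lmul_shift c : filt_shift 1 (lmul c).
Proof.
move=> i [x m] hx _; rewrite lmulE; split=> //=; rewrite addn1.
case: i hx => // i /(_ isT) /= [hx ->]; rewrite addr0.
by apply: addspan_gen; exists c, x.
Qed.

Lemma lmul_expr_eq0 c j : (n < j)%N -> lmul c ^+ j = 0.
Proof.
move=> nj; apply: (filt_shift_eq0 nj).
elim: (j) => [|k IH]; first exact: filt_shift1.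
by rewrite exprS -add1n; apply: filt_shiftM => //; apply: lmul_shift.
Qed.

Local Notation exp := (rexp q n).

(** An instance of [bch]: the filtration is by level shift, and the left multiplications form the
    Lie ring. *)
Lemma exp_lmulM c d : exists e, exp (lmul c) * exp (lmul d) = exp (lmul e).
Proof.
have [||||_ [e ->] ->] := @bch q n _ tor_endo cop filt_shift lie_lmul
  filt_shift_subgroup filt_shift1 filt_shiftM filt_shift_eq0
  lie_lmul_subgroup lie_lmul_br (lmul c) (lmul d).
- exact: lmul_shift.
- by exists c.
- exact: lmul_shift.
- by exists d.
by exists e.
Qed.

Lemma exp_lmulNK c : exp (lmul (- c)) * exp (lmul c) = 1.
Proof.
rewrite lmulN; apply: (rexp_oppK tor_endo cop) => j; exact: lmul_expr_eq0.
Qed.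

Lemma exp_lmul_inj c d : exp (lmul c) = exp (lmul d) -> c = d.
Proof.
move=> e; apply: lmul_inj.
by apply: (rexp_inj tor_endo cop _ _ e) => j; apply: lmul_expr_eq0.
Qed.

(** * The flow multiplication and the brace axioms *)

Local Notation lam := (expL n mul).
Local Notation W := (Wmap n mul).
Local Notation Om := (Omega n mul).
Local Notation circ := (flow_circ n mul).

Lemma unitization_Mn (x : A) k : ((x, 0) : B) *+ k = (x *+ k, 0).
Proof. by elim: k => // k IH; rewrite !mulrS IH; congr (_, _); rewrite /= addr0. Qed.

Lemma unitization_sum (I : Type) (r : seq I) (F : I -> A) :
  \sum_(i <- r) ((F i, 0) : B) = (\sum_(i <- r) F i, 0).
Proof.
rewrite (big_morph (fun x : A => (x, 0) : B) (id1 := 0) (op1 := +%R)) // => x y.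
by congr (_, _); rewrite /= addr0.
Qed.

Lemma expE (f : endo B) x : exp f x = \sum_(j < n.+1) iter j f x *+ ifact q j.
Proof.
by rewrite /rexp endo_sumE; apply: eq_bigr => j _; rewrite endoMnE endoXE.
Qed.

Lemma iter_lmul c x j : iter j (lmul c) (x, 0) = (iter j (mul c) x, 0).
Proof. by elim: j => //= j ->; rewrite lmulE addr0. Qed.

Lemma exp_lmulE c x : exp (lmul c) (x, 0) = (lam c x, 0).
Proof.
rewrite expE /expL -unitization_sum; apply: eq_bigr => j _.
by rewrite iter_lmul unitization_Mn divA_ifact // -ltnS.
Qed.

Lemma exp_lmul_one c : exp (lmul c) (0, 1) = (W c, 1).
Proof.
rewrite expE big_ord_recl (mulrn_ifact tor_unitization cop _ (leq0n n)) /Wmap big_add1 big_mkord /=.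
rewrite (eq_bigr (fun i : 'I_n => ((divA i.+1`! (iter i (mul c) c), 0) : B))).
  by rewrite unitization_sum; congr (_, _); rewrite /= ?add0r ?addr0.
move=> j _; rewrite /bump add1n -iterS iterSr lmul_one iter_lmul unitization_Mn.
by rewrite divA_ifact.
Qed.

Lemma exp_lmul_affineE c x : exp (lmul c) (x, 1) = (W c + lam c x, 1).
Proof.
have -> : (x, 1) = (0, 1) + (x, 0) :> B by congr (_, _); rewrite /= ?add0r ?addr0.
by rewrite endoD exp_lmulE exp_lmul_one; congr (_, _); rewrite /= addr0.
Qed.

(** If the exponential fixes the unit, the positive powers of [exp (lmul c) - 1] kill it; by
    [log_mem] so does [lmul c], which sends the unit to [c]. *)
Lemma Wmap_eq0 c : W c = 0 -> c = 0.
Proof.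
move=> Wc; pose T (f : endo B) := f (0, 1) = 0.
have sT : subgroup T.
  by split=> [|f g hf hg]; rewrite /T ?endo0E // endoBE hf hg subrr.
have nil j : (n < j)%N -> lmul c ^+ j = 0 by apply: lmul_expr_eq0.
have := log_mem tor_endo cop sT nil _ (ltn0Sn 0); rewrite expr1 /T lmul_one => h.
suff: (c, 0) = 0 :> B by case.
apply: h => -[//|k] _; rewrite exprSr /T endoME endoBE endo1E exp_lmul_one Wc subrr.
by rewrite endo0.
Qed.

Lemma exp_lmul0 : exp (lmul 0) = 1.
Proof. by rewrite lmul0 (rexp0 tor_endo cop). Qed.

Lemma Wmap_inj : injective W.
Proof.
move=> c d Wcd; apply: exp_lmul_inj.
(* This product of exponentials fixes the unit when [W c = W d], so [Wmap_eq0] makes it trivial. *)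
have [e he] := exp_lmulM (- d) c.
have e0 : e = 0.
  apply: Wmap_eq0; suff: (W e, 1) = (0, 1) :> B by case.
  rewrite -exp_lmul_one -he endoME exp_lmul_one Wcd -exp_lmul_one -endoME.
  by rewrite exp_lmulNK endo1E.
rewrite e0 exp_lmul0 in he.
rewrite -[LHS]mul1r -(exp_lmulNK (- d)) opprK -mulrA he mulr1 //.
Qed.

Lemma OmegaK a : W (Om a) = a.
Proof.
rewrite /Omega; case: pickP => [b /eqP //|h].
have [g _ gK] := injF_bij Wmap_inj.
by have := h (g a); rewrite gK eqxx.
Qed.

Lemma WmapK c : Om (W c) = c.
Proof. by apply: Wmap_inj; rewrite OmegaK. Qed.

(** Under [b] as [(b, 1)], [circ] is the action of exponentials on the affine copy of [A]; the group
    laws are checked there. *)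
Lemma flow_circE a b : exp (lmul (Om a)) (b, 1) = (circ a b, 1).
Proof. by rewrite exp_lmul_affineE OmegaK. Qed.

(** Both sides are exponentials with the same value at the unit, and that value determines the
    exponent since [W] is injective. *)
Lemma exp_Omega_circ a b :
  exp (lmul (Om (circ a b))) = exp (lmul (Om a)) * exp (lmul (Om b)).
Proof.
have [e he] := exp_lmulM (Om a) (Om b); rewrite he; congr (exp (lmul _)).
apply: Wmap_inj; rewrite OmegaK.
suff: (circ a b, 1) = (W e, 1) :> B by case.
by rewrite -exp_lmul_one -he endoME exp_lmul_one OmegaK flow_circE.
Qed.

Lemma flow_circA a b c : circ a (circ b c) = circ (circ a b) c.
Proof.
suff: (circ a (circ b c), 1) = (circ (circ a b) c, 1) :> B by case.
by rewrite -!flow_circE exp_Omega_circ endoME.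
Qed.

Lemma Omega0 : Om 0 = 0.
Proof.
apply: Wmap_eq0; exact: OmegaK.
Qed.

Lemma flow_circ0 a : circ 0 a = a.
Proof.
suff: (circ 0 a, 1) = (a, 1) :> B by case.
by rewrite -flow_circE Omega0 exp_lmul0 endo1E.
Qed.

Lemma expL0 c : lam c 0 = 0.
Proof.
suff: (lam c 0, 0) = 0 :> B by case.
by rewrite -exp_lmulE; apply: endo0.
Qed.

Lemma expLD c x y : lam c (x + y) = lam c x + lam c y.
Proof.
suff: (lam c (x + y), 0) = (lam c x + lam c y, 0) :> B by case.
rewrite -exp_lmulE (_ : (x + y, 0) = (x, 0) + (y, 0) :> B); last first.
  by congr (_, _); rewrite /= addr0.
by rewrite endoD !exp_lmulE; congr (_, _); rewrite /= addr0.
Qed.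

Lemma flow_circr0 a : circ a 0 = a.
Proof. by rewrite /flow_circ expL0 addr0. Qed.

Lemma flow_circV a : circ (W (- Om a)) a = 0.
Proof.
suff: (circ (W (- Om a)) a, 1) = (0, 1) :> B by case.
rewrite -flow_circE WmapK -{2}[a]flow_circr0 -flow_circE -endoME.
by rewrite exp_lmulNK endo1E.
Qed.

Lemma flow_circ_brace : left_brace circ.
Proof.
split; last by move=> a b c; rewrite /flow_circ expLD [RHS]addrACA addrAC.
split; first exact: flow_circA.
exists 0; split=> [x|x]; first by rewrite flow_circ0 flow_circr0.
have Vx := flow_circV x; set y := W _ in Vx; have Vy := flow_circV y.
set z := W _ in Vy; exists y; split=> //.
(* [z] is a left inverse of [y], itself a left inverse of [x]; associativity gives [z = x], so [y]
   is two-sided. *)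
have <- : z = x by rewrite -[z]flow_circr0 -Vx flow_circA Vy flow_circ0.
exact: Vy.
Qed.

(** * Left and right series of the brace *)

Lemma brace_starE a b : brace_star circ a b = lam (Om a) b - b.
Proof. by rewrite /brace_star /flow_circ [a + _ - a]addrAC subrr add0r. Qed.

Lemma expL_sub c x : lam c x - x = \sum_(j < n) iter j.+1 (mul c) x *+ ifact q j.+1.
Proof.
rewrite /expL big_ord_recl (divA_ifact _ (leq0n n)) (mulrn_ifact tor cop _ (leq0n n)).
rewrite addrC addKr; apply: eq_bigr => j _; rewrite lift0 divA_ifact //.
Qed.

Lemma iter_mul_mem (T : A -> Prop) c x k :
  (forall y, T y -> T (mul c y)) -> T x -> T (iter k (mul c) x).
Proof. by move=> Tc Tx; elim: k => //= k; apply: Tc. Qed.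

Lemma lpow_brace_star i x : lpow (brace_star circ) i x -> lpow mul i x.
Proof.
elim: i x => [//|[//|i] IH] x.
apply: addspan_min; first exact: addspan_subgroup.
move=> _ [a [b [_ [/IH hb ->]]]].
rewrite brace_starE expL_sub; apply: (subgroup_sum (addspan_subgroup _)) => j _.
apply: (subgroupMn (addspan_subgroup _)); rewrite iterS; apply: (@lpow_step _ mul i.+1) => //.
by apply: iter_mul_mem => // y hy; apply/lpow_decr/lpow_step.
Qed.

(** The pre-Lie identity rewrites c(uv) into products whose left factor is [u], cu or uc, all in the
    preceding power. *)
Lemma rpow_ideal i c x : rpow mul i x -> rpow mul i (mul c x).
Proof.
elim: i c x => [//|[//|i] IH] c x.
apply: (addspan_min (T := fun x => rpow mul i.+2 (mul c x))) => [|_ [u [v [hu [_ ->]]]]].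
  split=> [|y z hy hz]; first by rewrite mulx0; apply: addspan_0.
  by rewrite mulBr; apply: addspan_sub.
case: mul_prelie => _ _ /(_ c u v) e.
have -> : mul c (mul u v) = mul (mul c u) v - (mul (mul u c) v - mul u (mul c v)).
  by rewrite -e opprB addrCA subrr addr0.
apply: addspan_sub; first by apply: (@rpow_step _ mul i.+1) => //; apply: IH.
apply: addspan_sub; last exact: (@rpow_step _ mul i.+1).
by apply: (@rpow_step _ mul i.+1) => //; apply/rpow_decr/rpow_step.
Qed.

Lemma rpow_Wmap i c : rpow mul i c -> rpow mul i (W c).
Proof.
move=> hc; rewrite /Wmap big_add1 big_mkord /=.
apply: (subgroup_sum (rpow_subgroup _ _)) => j _; rewrite divA_ifact //.
apply: (subgroupMn (rpow_subgroup _ _)).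
by apply: iter_mul_mem => // y; apply: rpow_ideal.
Qed.

(* [W] permutes the finite set [A], so [Omega] is a power of [W]. *)
Lemma rpow_Omega i a : rpow mul i a -> rpow mul i (Om a).
Proof.
move=> ha; have -> : Om a = finv W a by apply: Wmap_inj; rewrite OmegaK (f_finv Wmap_inj).
by rewrite /finv; elim: _.-1 => //= k; apply: rpow_Wmap.
Qed.

(** Forward, the star product is a sum of iterates of left multiplication by [Om a], which stays in
    the ideal. Backward, [log_mem] recovers [lmul c] from star products by [W c]. *)
Lemma rpow_brace_star i x : rpow (brace_star circ) i x <-> rpow mul i x.
Proof.
elim: i x => [//|[//|i] IH] x; split.
  apply: addspan_min; first exact: addspan_subgroup.
  move=> _ [a [b [/IH ha [_ ->]]]].
  rewrite brace_starE expL_sub; apply: (subgroup_sum (addspan_subgroup _)) => j _.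
  apply: (subgroupMn (addspan_subgroup _)); rewrite iterS.
  by apply: (@rpow_step _ mul i.+1) => //; apply: rpow_Omega.
apply: addspan_min; first exact: addspan_subgroup.
move=> _ [c [b [hc [_ ->]]]].
have hW : rpow (brace_star circ) i.+1 (W c) by apply/IH/rpow_Wmap.
(* The operators sending the fixed [b] into the next right power; [EE] puts the positive powers of
   [exp (lmul c) - 1] among them. *)
pose T (f : endo B) :=
  exists2 y, f (b, 0) = (y, 0) & rpow (brace_star circ) i.+2 y.
have sT : subgroup T.
  split=> [|f g [y fy hy] [z gz hz]].
    by exists 0; [rewrite endo0E | apply: addspan_0].
  exists (y - z); last exact: addspan_sub.
  by rewrite endoBE fy gz; congr (_, _); rewrite /= subrr.
have EE z : (exp (lmul c) - 1) (z, 0) = (brace_star circ (W c) z, 0).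
  rewrite brace_starE WmapK endoBE endo1E exp_lmulE.
  by congr (_, _); rewrite /= subrr.
have nil j : (n < j)%N -> lmul c ^+ j = 0 by apply: lmul_expr_eq0.
have [] := log_mem tor_endo cop sT nil _ (ltn0Sn 0).
  move=> [//|k] _.
  have [z ez] : exists z, ((exp (lmul c) - 1) ^+ k) (b, 0) = (z, 0).
    elim: k => [|k [z ez]]; first by exists b; rewrite endo1E.
    by exists (brace_star circ (W c) z); rewrite exprS endoME ez EE.
  exists (brace_star circ (W c) z); first by rewrite exprS endoME ez EE.
  exact: (@rpow_step _ (brace_star circ) i.+1).
by move=> y; rewrite expr1 lmulE addr0 => -[->].
Qed.

Lemma endo_unitizationP (f g : endo B) :
  (forall x, f (x, 0) = g (x, 0)) -> f (0, 1) = g (0, 1) -> f = g.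
Proof.
move=> e e1; apply/endoP => -[x m].
have -> : (x, m) = (x, 0) + (0, 1) *+ m :> B.
  have Mn k : ((0, 1) : B) *+ k = (0, k%:R).
    by elim: k => // k IH; rewrite !mulrS IH; congr (_, _); rewrite /= addr0.
  by rewrite Mn natr_Zp; congr (_, _); rewrite /= ?addr0 ?add0r.
have Mn (h : endo B) k : h ((0, 1) *+ k) = h (0, 1) *+ k.
  by elim: k => [|k IH]; rewrite ?endo0 // !mulrS endoD IH.
by rewrite !endoD !Mn e e1.
Qed.
End PreLie.

(** * The brace determines the pre-Lie product *)

Section Faithful.
Variables (A : finZmodType) (q0 n : nat).
Local Notation q := q0.+2.
Local Notation B := (unitization A q0).
Hypothesis tor : forall x : A, x *+ q = 0.
Hypothesis cop : factorials_coprime q n.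
Variables mul1 mul2 : A -> A -> A.
Hypothesis pl1 : prelie mul1.
Hypothesis pl2 : prelie mul2.
Hypothesis nil1 : forall k x, (n < k)%N -> lpow mul1 k x -> x = 0.
Hypothesis nil2 : forall k x, (n < k)%N -> lpow mul2 k x -> x = 0.

Lemma flow_circ_inj :
  (forall a b, flow_circ n mul1 a b = flow_circ n mul2 a b) ->
  forall a b, mul1 a b = mul2 a b.
Proof.
(* With this [a], the first structure's flow of [a] is governed by [c]; both flows send the unit to
   [(a, 1)] and agree on [A], so the exponentials coincide. *)
move=> e c x; set a := Wmap n mul1 c.
have eE : rexp q n (lmul tor pl1 c) = rexp q n (lmul tor pl2 (Omega n mul2 a)).
  apply: endo_unitizationP => [y|].
    rewrite !exp_lmulE //; congr (_, _); apply: (addrI a).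
    by rewrite -{1}(WmapK tor cop pl1 nil1 c); apply: e.
  by rewrite !exp_lmul_one // (OmegaK tor cop pl2 nil2).
have el : lmul tor pl1 c = lmul tor pl2 (Omega n mul2 a).
  by apply: (rexp_inj (tor_endo tor) cop _ _ eE) => j; apply: lmul_expr_eq0.
have ec : c = Omega n mul2 a.
  by move/endoP/(_ (0, 1)): el; rewrite !lmul_one => -[].
rewrite -ec in el.
by move/endoP/(_ (x, 0)): el; rewrite !lmulE !addr0 => -[].
Qed.
End Faithful.

(** * The nilpotency class *)

(** Translation by [x] permutes [A]; compare the sum of all elements before and after. *)
Lemma mulrn_card (A : finZmodType) (x : A) : x *+ #|A| = 0.
Proof.
have := reindex_inj (addIr x) (P := xpredT) (F := id) (op := +%R) (x := 0).
rewrite big_split /= sumr_const => e.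
by apply: (addrI (\sum_(i : A) i)); rewrite addr0 -e.
Qed.

Lemma factorials_coprime_prime p n e :
  prime p -> (n < p)%N -> factorials_coprime (p ^ e) n.
Proof.
move=> pp np j jn; apply: coprimeXr; rewrite coprime_sym prime_coprime //.
elim: j jn => [|j IH] jn; first by rewrite fact0 dvdn1; case: p pp {np jn} => [|[]].
by rewrite factS Euclid_dvdM // negb_or IH ?(ltnW jn) // gtnNdvd //; lia.
Qed.

Section NilpotencyClass.
Variables (A : finZmodType) (p n : nat).
Hypothesis p_prime : prime p.
Hypothesis cardA : #|A| = (p ^ n)%N.

(** The translates of [S] by the first [p] multiples of [x] are disjoint: a difference [d] with
    [0 < d < p] is invertible modulo [p ^ n], so [x *+ d] in [S] would put [x] in [S]. *)
Lemma subgroup_index (S T : {set A}) x :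
  subgroup (fun y => y \in S) -> subgroup (fun y => y \in T) ->
  S \subset T -> x \in T -> x \notin S -> (p * #|S| <= #|T|)%N.
Proof.
move=> sS sT /subsetP ST xT xS.
have torA (y : A) : y *+ (p ^ n) = 0 by rewrite -cardA mulrn_card.
pose f (u : 'I_p * A) := x *+ u.1 + u.2.
have wlog_inj u v : u.2 \in S -> v.2 \in S -> f u = f v -> (u.1 <= v.1)%N -> u.1 = v.1.
  move=> uS vS e le; apply/eqP; apply: contraNT xS => ne.
  set d := (v.1 - u.1)%N.
  have d0 : (0 < d)%N by rewrite subn_gt0 ltn_neqAle le andbT; apply: contraNneq ne => /val_inj ->.
  have cd : coprime d (p ^ n).
    apply: coprimeXr; rewrite coprime_sym prime_coprime // gtnNdvd //.
    by rewrite /d; have := ltn_ord v.1; lia.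
  have -> : x = x *+ d *+ invmod (p ^ n) d.
    by rewrite -mulrnA (mulrn_eqmod torA _ (invmodP d0 cd)).
  apply: (subgroupMn sS); suff -> : x *+ d = u.2 - v.2 by apply: (subgroupB sS).
  by rewrite /d mulrnBr //; apply/eqP; rewrite subr_eq addrAC eq_sym subr_eq addrC; apply/eqP.
have inj : {in setX [set: 'I_p] S &, injective f}.
  move=> [a b] [c d] /setXP[_ bS] /setXP[_ dS] e.
  have e1 : a = c.
    case/orP: (leq_total a c) => le; first exact: (wlog_inj (a, b) (c, d)).
    exact/esym/(wlog_inj (c, d) (a, b)).
  by move: e; rewrite /f /= e1 => /addrI ->.
have <- : #|f @: setX [set: 'I_p] S| = (p * #|S|)%N.
  by rewrite card_in_imset // cardsX cardsT card_ord.
apply/subset_leq_card/subsetP => _ /imsetP[[a b] /setXP[_ bS] ->].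
by apply: (subgroupD sT); [apply: (subgroupMn sT) | apply: ST].
Qed.

(** Each of the first [n] steps of the series divides the order by at least [p], so the term of
    index [n.+1] has at most one element. *)
Lemma lpow_card_nil (op : A -> A -> A) : left_nilpotent op ->
  forall k x, (n < k)%N -> lpow op k x -> x = 0.
Proof.
move=> [m nilm] k x nk hx; apply/eqP; apply/negPn/negP => x0.
pose L i := [set y : A | `[< lpow op i y >]].
have LP i y : (y \in L i) <-> lpow op i y by rewrite inE; split=> /asboolP.
have sL i : subgroup (fun y => y \in L i).
  split=> [|y z /LP hy /LP hz]; apply/LP; first exact: subgroup0 (lpow_subgroup op i).
  exact: (subgroupB (lpow_subgroup op i)).
have down i j y : (i <= j)%N -> lpow op j y -> lpow op i y.
  move=> ij; rewrite -(subnK ij); elim: (j - i)%N => // d IH /lpow_decr; exact: IH.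
have card_L i : (i <= n)%N -> (p ^ i * #|L i.+1| <= p ^ n)%N.
  elim: i => [_|i IH i_n]; first by rewrite mul1n -cardA max_card.
  apply: leq_trans (IH (ltnW i_n)); rewrite expnSr -mulnA leq_mul2l; apply/orP; right.
  have [stable|] := boolP (L i.+1 \subset L i.+2); last first.
    case/subsetPn => y yL yL'; apply: (subgroup_index (sL _) (sL _) _ yL yL').
    by apply/subsetP => z /LP hz; apply/LP/lpow_decr.
  (* Once the series stalls it is constant, and nilpotency then kills the nonzero [x]. *)
  have all_eq j y : lpow op i.+1 y -> lpow op (i.+1 + j) y.
    elim: j y => [|j IHj] y; first by rewrite addn0.
    move=> hy; have /LP : y \in L i.+2 by apply: (subsetP stable); apply/LP.
    apply: addspan_min; first exact: lpow_subgroup.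
    by move=> _ [c [z [_ [hz ->]]]]; rewrite addnS; apply: lpow_step => //; apply: IHj.
  case/eqP: x0; apply: nilm; apply: (@down m (i.+1 + m)%N); first exact: leq_addl.
  by apply/all_eq/(down _ k) => //; lia.
have := card_L n (leqnn n); rewrite -{2}[(p ^ n)%N]muln1 leq_pmul2l ?expn_gt0 ?prime_gt0 //.
have : [set 0; x] \subset L n.+1.
  apply/subsetP => y; rewrite !inE => /orP[] /eqP ->; apply/asboolP.
    exact: subgroup0 (lpow_subgroup _ _).
  exact: down nk hx.
move=> /subset_leq_card; rewrite cards2 eq_sym x0 => h1 h2.
by have := leq_trans h1 h2.
Qed.
End NilpotencyClass.

Local Close Scope ring_scope.

Theorem theorem2 (p n : nat) (A : finZmodType) :
  prime p -> n.+1 < p -> #|A| = p ^ n ->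
  (forall mul : A -> A -> A, prelie mul -> left_nilpotent mul ->
     [/\ left_brace (flow_circ n mul),
         left_nilpotent (brace_star (flow_circ n mul)) &
         (right_nilpotent (brace_star (flow_circ n mul)) <-> right_nilpotent mul)])
  /\
  (forall mul1 mul2 : A -> A -> A,
     prelie mul1 -> left_nilpotent mul1 ->
     prelie mul2 -> left_nilpotent mul2 ->
     (exists a b, mul1 a b <> mul2 a b) ->
     exists a b, flow_circ n mul1 a b <> flow_circ n mul2 a b).
Proof.
move=> pp np cA.
(* The modulus is [p ^ n.+1] because it is at least 2 even for [n = 0]; it still kills [A] and is
   prime to the factorials. *)
have eq : (p ^ n.+1 = (p ^ n.+1).-2.+2)%N.
  have : (1 < p ^ n.+1)%N by rewrite -{1}(exp1n n.+1) ltn_exp2r // prime_gt1.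
  by case: (p ^ n.+1)%N => [|[]].
have cop : factorials_coprime (p ^ n.+1).-2.+2 n.
  by rewrite -eq; apply: factorials_coprime_prime => //; apply: ltnW.
have tor (x : A) : (x *+ (p ^ n.+1).-2.+2 = 0)%R.
  by rewrite -eq expnSr mulrnA -cA mulrn_card mul0rn.
have nil := lpow_card_nil pp cA.
split=> [mul pl ln|mul1 mul2 pl1 ln1 pl2 ln2 [a [b ne]]].
  split.
  - exact: (flow_circ_brace tor cop pl (nil _ ln)).
  - exists n.+1 => x hx; apply: (nil _ ln _ _ (ltnSn n)).
    exact: (lpow_brace_star tor cop).
  have rE := rpow_brace_star tor cop pl (nil _ ln).
  by split=> -[m hm]; exists m => x hx; apply: hm; apply/rE.
have [e|] := boolP [forall a, forall b, flow_circ n mul1 a b == flow_circ n mul2 a b].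
  case: ne; apply: (flow_circ_inj tor cop pl1 pl2 (nil _ ln1) (nil _ ln2)) => c d.
  by have /forallP/(_ c)/forallP/(_ d)/eqP := e.
by case/forallPn => c /forallPn[d /eqP ned]; exists c, d.
Qed.
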